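(* Let $I\subset\mathbf k[\mathbf x]$ be a monomial ideal with cofinite support and $x_i\notin I$ for all $i$, and let $E_{\min}\subseteq E\cap\mathcal R(I)$ be a set of minimal roots as defined in the context. Then the Lie algebra $\mathfrak g=\operatorname{Der}_{\mathbf k}(\mathbf k[\mathbf x]/I)$ is generated by $\mathfrak t\cup\bigcup_\alpha\mathfrak g_\alpha$, where $\alpha$ ranges over $\widetilde G(I)$, all inner roots $e_i\in E_{\min}$, and all irreducible roots of the form $2e_i$.
   Context: Setting: $\mathbf k$ is an algebraically closed field of characteristic zero, $n\ge1$, $M=\mathbb Z^n$ with canonical basis $E=\{e_1,\dots,e_n\}$, and $N_{\mathbf k}=\operatorname{Hom}(M,\mathbf k)\cong\mathbf k^n$ with dual basis $e_1^*,\dots,e_n^*$. $\mathbf k[\mathbf x]=\mathbf k[x_1,\dots,x_n]$ and $\mathbf x^m=x_1^{m_1}\cdots x_n^{m_n}$. For a monomial ideal $I$, $\operatorname{supp}(I)=\{m\in\mathbb Z^n_{\ge0}:\mathbf x^m\in I\}$; $I$ has cofinite support if $\mathbb Z^n_{\ge0}\setminus\operatorname{supp}(I)$ is finite. Set $A=\mathbf k[\mathbf x]/I$. For $\alpha\in\mathbb Z^n$ and $p\in N_{\mathbf k}$, $\partial_{\alpha,p}$ denotes the homogeneous derivation $\mathbf x^m\mapsto p(m)\mathbf x^{m+\alpha}$ of $\mathbf k[\mathbf x]$ (whenever it maps $\mathbf k[\mathbf x]$ to itself), and $\overline\partial_{\alpha,p}$ the derivation induced on $A$ when $\partial_{\alpha,p}(I)\subseteq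 I$. A degree $\alpha$ is inner if $\alpha\in\mathbb Z_{\ge0}^n$ and outer otherwise. Put $E_\alpha=\{e_i\in E : \alpha+e_i\in\mathbb Z^n_{\ge0}\setminus\operatorname{supp}(I)\}$. A root is a degree $\alpha\ne0$ for which there is a nonzero homogeneous derivation of $A$ of degree $\alpha$; $\mathcal R(I)$ is the set of roots. Explicitly, an inner $\alpha\neq 0$ is a root iff $E_\alpha\neq\varnothing$; an outer $\alpha$ is a root iff it has exactly one negative coordinate, say $\alpha_k=-1$, for every $\beta\in\operatorname{supp}(I)$ either $\alpha+\beta\in\operatorname{supp}(I)$ or $\alpha+\beta\notin\mathbb Z^n_{\ge0}$, and $E_\alpha\ne\varnothing$ (then $E_\alpha=\{e_k\}$). $N(\alpha)=\bigoplus_{e_i\in E_\alpha}\mathbf k e_i^*$ for inner roots, $N(\alpha)=\mathbf k e_k^*$ for outer roots with $\alpha_k=-1$. $\mathfrak g=\operatorname{Der}_{\mathbf k}(A)=\mathfrak t\oplus\bigoplus_{\alpha\in\mathcal R(I)}\mathfrak g_\alpha$ with $\mathfrak g_\alpha=\{\overline\partial_{\alpha,p}:p\in N(\alpha)\}$ and $\mathfrak t=\mathfrak g_0=\{\overline\partial_{0,p}:p\in N_{\mathbf k}\}$. For a root $\gamma$, $B_\gamma=\sum[\mathfrak g_\alpha,\mathfrak g_\beta]$, sum over $\alpha,\beta\in\mathcal R(I)$ with $\alpha+\beta=\gamma$; $\gamma$ is reducible if $B_\gamma=\mathfrak g_\gamma$ and irreducible otherwise. Write $e_i\succ e_j$ if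 $e_i-e_j\in\mathcal R(I)$. A set of minimal roots is a subset $E_{\min}\subseteq E\cap\mathcal R(I)$ such that for every $e_k\in E\cap\mathcal R(I)$ there is $e_i\in E_{\min}$ with $e_k\succ e_i$ or $e_k=e_i$, and such that there is no relation $e_j\succ e_i$ with $e_i,e_j\in E_{\min}$ distinct. For each $i$ let $J_i=I:(I:(x_i))$ (colon ideals), a monomial ideal with minimal monomial generating set $G(J_i)$, and set $\widetilde G(I)=\bigcup_{i=1}^n\{\beta-e_i:\mathbf x^\beta\in G(J_i),\ \beta_i=0,\ \mathbf x^\beta\notin I\}$; it is a finite set of outer roots. *)

(* Defs.v *)
From HB Require Import structures.
From mathcomp Require Import all_boot all_order all_algebra.
From mathcomp Require Export ring_quotient.
From mathcomp Require Export mpoly.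

Set Implicit Arguments.
Unset Strict Implicit.
Unset Printing Implicit Defensive.

Import GRing.Theory Quotient.

Local Open Scope ring_scope.
Local Open Scope quotient_scope.

(* The quotient of a commutative k-algebra by an ideal, as a k-algebra. The    *)
(* library only provides its ring structure.                                   *)
Section QuotientAlgebra.
Variables (k : nzRingType) (R : comAlgType k) (I : idealr R).
Implicit Types (c : k) (a b : {ideal_quot I}).

Definition qscale c a : {ideal_quot I} := \pi_({ideal_quot I}) (c%:A : R) * a.

Fact qscaleA c d a : qscale c (qscale d a) = qscale (c * d) a.
Proof.
by rewrite /qscale mulrA -rmorphM /= -scalerAl mul1r scalerA.
Qed.

Fact qscale1 : left_id 1 qscale.
Proof. by move=> a; rewrite /qscale scale1r rmorph1 mul1r. Qed.

Fact qscaleDr : right_distributive qscale +%R.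
Proof. by move=> c a b; rewrite /qscale mulrDr. Qed.

Fact qscaleDl a : {morph qscale^~ a : c d / c + d}.
Proof. by move=> c d; rewrite /qscale scalerDl rmorphD mulrDl. Qed.

HB.instance Definition _ := GRing.Zmodule_isLmodule.Build k {ideal_quot I}
  qscaleA qscale1 qscaleDr qscaleDl.

Fact qscaleAl c a b : c *: (a * b) = c *: a * b.
Proof. exact: mulrA. Qed.

HB.instance Definition _ :=
  GRing.Lmodule_isLalgebra.Build k {ideal_quot I} qscaleAl.

Fact qscaleAr c a b : c *: (a * b) = a * (c *: b).
Proof. exact: mulrCA. Qed.

HB.instance Definition _ :=
  GRing.Lalgebra_isAlgebra.Build k {ideal_quot I} qscaleAr.

Fact pi_scale c (f : R) : \pi_({ideal_quot I}) (c *: f) = c *: \pi_({ideal_quot I}) f.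
Proof. by rewrite -[f in LHS]mul1r scalerAl rmorphM. Qed.

End QuotientAlgebra.

(* Derivations of a k-algebra A and Lie subalgebras of its k-linear maps. Sets *)
(* of maps A -> A are predicates closed under pointwise equality, so that no   *)
(* functional extensionality is needed.                                        *)
Section LieAlgebra.
Variables (k : comNzRingType) (A : comAlgType k).
Implicit Types (D : A -> A) (S L : (A -> A) -> Prop).

Definition derivation D : Prop :=
  linear D /\ forall a b, D (a * b) = D a * b + a * D b.

Definition lie_bracket D1 D2 : A -> A := fun a => D1 (D2 a) - D2 (D1 a).

Definition subspace L : Prop :=
  [/\ forall D1 D2, D1 =1 D2 -> L D1 -> L D2,
      L (fun=> 0) &
      forall c D1 D2, L D1 -> L D2 -> L (fun a => c *: D1 a + D2 a)].

Definition lie_subalgebra L : Prop :=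
  subspace L /\ forall D1 D2, L D1 -> L D2 -> L (lie_bracket D1 D2).

Definition linear_span S D : Prop :=
  forall L, subspace L -> (forall D', S D' -> L D') -> L D.

Definition lie_generated S D : Prop :=
  forall L, lie_subalgebra L -> (forall D', S D' -> L D') -> L D.

End LieAlgebra.

Section Ideals.
Variable R : comNzRingType.
Implicit Types (J K : R -> Prop).

Definition principal (f : R) : R -> Prop := fun g => exists h, g = h * f.

Definition colon J K : R -> Prop := fun f => forall g, K g -> J (f * g).

End Ideals.

Section MonomialIdeals.
Variables (k : nzRingType) (n : nat).
Implicit Types (G : 'X_{1..n} -> Prop) (J : {mpoly k[n]} -> Prop).

Definition generated_by G : {mpoly k[n]} -> Prop := fun f =>
  exists s : seq ({mpoly k[n]} * 'X_{1..n}),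
    (forall u, u \in s -> G u.2) /\ f = \sum_(u <- s) u.1 * 'X_[u.2].

Definition generates G J : Prop := forall f, J f <-> generated_by G f.

Definition is_monomial_ideal J : Prop := exists G, generates G J.

Definition is_minimal_gens G J : Prop :=
  generates G J /\
  forall G', (forall m, G' m -> G m) -> generates G' J ->
    forall m, G m -> G' m.

Definition minimal_gen J (m : 'X_{1..n}) : Prop :=
  exists G, is_minimal_gens G J /\ G m.

End MonomialIdeals.

(* Degrees live in Z^n, represented by integer row vectors.                    *)
Section Degrees.
Variable n : nat.
Implicit Types (a : 'rV[int]_n) (m : 'X_{1..n}).

Definition deg_of m : 'rV[int]_n := \row_i (m i)%:Z.

Definition nonneg a : bool := [forall i, 0 <= a 0 i].

(* The exponent of the monomial x^a; relevant only when [nonneg a].            *)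
Definition mnm_of a : 'X_{1..n} := [multinom `|a 0%R i|%N | i < n].

Definition ebase (i : 'I_n) : 'rV[int]_n := delta_mx 0 i.

(* N_k = Hom(Z^n, k) is identified with k^n through the dual basis; this is    *)
(* the evaluation p(a).                                                        *)
Definition pairing (k : nzRingType) (p : 'rV[k]_n) a : k :=
  \sum_i p 0 i * (a 0 i)%:~R.

End Degrees.

Section Roots.
Variables (k : fieldType) (n : nat) (I : idealr {mpoly k[n]}).

Local Notation A := ({ideal_quot I}).
Implicit Types (a b g : 'rV[int]_n) (p : 'rV[k]_n) (D : A -> A).

(* x^a, with value 0 when a has a negative coordinate.                         *)
Definition xpow a : {mpoly k[n]} := if nonneg a then 'X_[mnm_of a] else 0.

Definition hder a p (f : {mpoly k[n]}) : {mpoly k[n]} :=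
  \sum_(m <- msupp f) (f@_m * pairing p (deg_of m)) *: xpow (deg_of m + a).

(* The rule x^m |-> p(m) x^(m+a) maps k[x] to itself: no monomial with a       *)
(* negative exponent occurs with a nonzero coefficient.                        *)
Definition hder_defined a p : Prop :=
  forall m : 'X_{1..n}, pairing p (deg_of m) != 0 -> nonneg (deg_of m + a).

Definition is_induced_hder a p D : Prop :=
  [/\ hder_defined a p,
      forall f, f \in I -> hder a p f \in I &
      forall f, D (\pi_A f) = \pi_A (hder a p f)].

Definition cofinite_support : Prop :=
  exists s : seq 'X_{1..n}, forall m, 'X_[m] \notin I -> m \in s.

(* A is graded by Z^n, the component of degree b being spanned by the class of *)
(* x^b (and zero if b has a negative coordinate).                              *)
Definition homogeneous a D : Prop :=
  forall m : 'X_{1..n}, exists c : k,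
    D (\pi_A 'X_[m]) = c *: \pi_A (xpow (deg_of m + a)).

Definition is_root a : Prop :=
  a != 0 /\
  exists D, [/\ derivation D, homogeneous a D & exists x, D x != 0].

Definition Eset a : {set 'I_n} :=
  [set i | nonneg (a + ebase i) && ('X_[mnm_of (a + ebase i)] \notin I)].

Definition Nspace a p : Prop :=
  if nonneg a then forall i, i \notin Eset a -> p 0 i = 0
  else exists2 l, a 0 l = -1 & forall i, i != l -> p 0 i = 0.

Definition torus D : Prop := exists p, is_induced_hder 0 p D.

Definition root_space a D : Prop :=
  exists2 p, Nspace a p & is_induced_hder a p D.

Definition bracket_space g : (A -> A) -> Prop :=
  linear_span (fun D => exists a b D1 D2,
    [/\ is_root a /\ is_root b, a + b = g, root_space a D1, root_space b D2 &
        D =1 lie_bracket D1 D2]).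

Definition reducible_root g : Prop :=
  is_root g /\ forall D, bracket_space g D <-> root_space g D.

Definition irreducible_root g : Prop := is_root g /\ ~ reducible_root g.

Definition succ_e (i j : 'I_n) : Prop := is_root (ebase i - ebase j).

Definition is_minimal_roots (Emin : {set 'I_n}) : Prop :=
  [/\ forall i, i \in Emin -> is_root (ebase i),
      forall l, is_root (ebase l) ->
        exists2 i, i \in Emin & succ_e l i \/ l = i &
      forall i j, i \in Emin -> j \in Emin -> i != j -> ~ succ_e j i].

Definition Jideal (i : 'I_n) : {mpoly k[n]} -> Prop :=
  colon (fun f => f \in I) (colon (fun f => f \in I) (principal 'X_i)).

Definition Gtilde a : Prop :=
  exists (i : 'I_n) (m : 'X_{1..n}),
    [/\ minimal_gen (Jideal i) m, m i = 0%N, 'X_[m] \notin I &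
        a = deg_of m - ebase i].

End Roots.

(* Main.v *)
From HB Require Import structures.
Require Import Defs.
From mathcomp Require Import all_boot all_order all_algebra.
From mathcomp Require Import ring.
From Stdlib Require Import Classical.

(** Write [A] for the quotient, [d_i] for the partial derivatives and
    [H_i = x_i d_i].

    The target of the generation is a span of monomial vector fields. A
    derivation of [A] is determined by the classes of its values on the
    variables, so it lifts to [sum_i v_i d_i] with polynomials [v_i]; since [I]
    is spanned by monomials, comparing coefficients shows that each term
    [x^b d_i] of this sum maps [I] to itself ([derivation_lifted]). Hence it is
    enough that a Lie subalgebra [L] containing the generators contains the
    class of every [x^b d_i] that preserves [I]. If [b_i > 0] this field is
    [x^c H_i] with [c = b - e_i], of inner degree [c], or in the torus when
    [c = 0]. If [b_i = 0] it has outer degree [b - e_i], and it preserves [I]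
    exactly when [x^b] lies in [J_i] ([preserving_Jideal]).

    The rest is a chain of brackets, all instances of
    [[x^a d_i, x^b d_j] = b_i x^(a+b-e_i) d_j - a_j x^(a+b-e_j) d_i].

    - If [e_l - e_i] is a root then [x_l] is a minimal generator of [J_i],
      because cofiniteness of the support keeps [1] out of [J_i]. So [x_l d_i]
      is available ([lifted_shift]), and bracketing it with the [x_i H_j],
      where [e_i] is a minimal root below [e_l], gives all [x_l H_j]
      ([lifted_quadratic]).
    - Every monomial of [J_i] free of [x_i] is a minimal generator times a
      monomial free of [x_i]; the extra variables are attached one at a time
      by bracketing with [x_l H_i] ([lifted_outer]).
    - An inner [x^a H_j] of degree [|a| >= 2] is a bracket of fields of lower
      inner degree, with the single exception [a = 2 e_j], where the
      structure constant of [[x_j H_j, x_j H_j]] vanishes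
      ([lifted_inner_step]).
    - When [2 e_j] is irreducible its root space is among the generators.
      Otherwise that space is spanned by brackets of root spaces of degrees
      [a + b = 2 e_j]. Such an [a] is outer, or is inner with [|a| <= 2] and
      is not of the form [2 e_i], so the previous steps already cover it
      ([double_root_summand]).

    Induction on [|a|] then yields all inner fields. Conversely the generators
    are derivations, and derivations form a Lie algebra.

    Computations are made with operators on polynomials and transferred to
    [A] by the predicate [lifted], which says that an operator induces a map
    belonging to [L]. *)

Set Implicit Arguments.
Unset Strict Implicit.
Unset Printing Implicit Defensive.
Import GRing.Theory Quotient.
Local Open Scope ring_scope.
Local Open Scope quotient_scope.

(** * Monomial ideals and their minimal generators *)

Section MonomialIdealTheory.
Variables (k : fieldType) (n : nat).
Implicit Types (f g : {mpoly k[n]}) (m b c u : 'X_{1..n}).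
Implicit Types (J K : {mpoly k[n]} -> Prop).

Definition is_ideal J :=
  [/\ J 0, forall f g, J f -> J g -> J (f + g) & forall f g, J g -> J (f * g)].

(** For an ideal this is equivalent to being generated by monomials, and it
    passes to colon ideals without exhibiting generators. *)
Definition monomial_closed J :=
  forall f m, J f -> m \in msupp f -> J 'X_[m].

Lemma ideal_sum (T : eqType) J (r : seq T) (F : T -> {mpoly k[n]}) :
  is_ideal J -> (forall x, x \in r -> J (F x)) -> J (\sum_(x <- r) F x).
Proof. by case=> J0 JD _ JF; rewrite big_seq; apply: (big_ind J). Qed.

Lemma ideal_le J m b : is_ideal J -> (m <= b)%MM -> J 'X_[m] -> J 'X_[b].
Proof. by case=> _ _ JM /submK <- Jm; rewrite mpolyXD; apply: JM. Qed.

Lemma generated_by_msupp (G : 'X_{1..n} -> Prop) f m :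
  generated_by G f -> m \in msupp f -> exists2 u, G u & (u <= m)%MM.
Proof.
case=> s [Gs ->] /msupp_sum_le /flattenP[? /mapP[u us ->]].
move=> /msuppM_le /allpairsP[[m1 m2] /= [_]].
rewrite filter_predT in us; rewrite msuppX inE => /eqP -> ->.
by exists u.2; [apply: Gs | rewrite lem_addl].
Qed.

Lemma monomial_ideal_closed J : is_monomial_ideal J -> monomial_closed J.
Proof.
case=> G JG f m /JG /generated_by_msupp Jf /Jf[u Gu le_um]; apply/JG.
exists [:: ('X_[m - u], u)]; split => [v|]; first by rewrite inE => /eqP ->.
by rewrite big_seq1 -mpolyXD submK.
Qed.

Lemma ideal_colon J K : is_ideal J -> is_ideal (colon J K).
Proof.
case=> J0 JD JM; split=> [g _|f g Jf Jg h Kh|f g Jg h Kh].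
- by rewrite mul0r.
- by rewrite mulrDl; apply: JD; [apply: Jf | apply: Jg].
- by rewrite -mulrA; apply/JM/Jg.
Qed.

(** For [f] in the colon ideal and a monomial [c] of some [g] in [K], the
    product of [f] with [x^c] is in [J], hence so are its monomials
    [x^(m + c)]: testing against the monomials of [K] suffices. *)
Lemma colon_monomial_closed J K : is_ideal J -> monomial_closed J ->
  monomial_closed K -> monomial_closed (colon J K).
Proof.
move=> Jid Jmon Kmon f m Jf m_f g Kg; rewrite [g]mpolyE mulr_sumr.
have [_ _ JM] := Jid; apply: ideal_sum => // c c_g.
rewrite -scalerAr -mul_mpolyC; apply: JM; rewrite -mpolyXD.
by apply: (Jmon (f * 'X_[c])); [apply/Jf/(Kmon g) | rewrite (perm_mem (msuppMX _ _)) addmC map_f].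
Qed.

Lemma principal_monomial_closed m : monomial_closed (principal ('X_[m] : {mpoly k[n]})).
Proof.
move=> _ c [h ->]; rewrite (perm_mem (msuppMX _ _)) => /mapP[d _ ->].
by exists 'X_[d]; rewrite addmC mpolyXD.
Qed.

(** The exponents of [J] that are minimal for divisibility form a minimal
    generating set: each exponent of [J] is above one of them by descent on the
    degree, and none can be dropped, being divisible only by itself among the
    monomials of [J]. *)
Lemma minimal_gen_le J b : is_ideal J -> monomial_closed J -> J 'X_[b] ->
  exists2 m, minimal_gen J m & (m <= b)%MM.
Proof.
move=> Jid Jmon.
pose G m := J 'X_[m] /\ forall m', (m' <= m)%MM -> J 'X_[m'] -> m' = m.
have Gle c : J 'X_[c] -> exists2 m, G m & (m <= c)%MM.
  have [d] := ubnP (mdeg c); elim: d c => // d IHd c le_cd Jc.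
  have [Gc|nGc] := classic (G c); first by exists c; rewrite ?lepm_refl.
  have [m [le_mc Jm ne_mc]] : exists m, [/\ (m <= c)%MM, J 'X_[m] & m <> c].
    apply: NNPP => Nm; case: nGc; split=> // m le_mc Jm; apply: NNPP => ne_mc.
    by apply: Nm; exists m.
  have lt_mc : (mdeg m < mdeg c)%N.
    rewrite -(submK le_mc) mdegD -[X in (X < _)%N]add0n ltn_add2r lt0n mdeg_eq0.
    by apply/eqP => c_m; apply: ne_mc; rewrite -(submK le_mc) c_m add0m.
  have [u Gu le_um] := IHd m (leq_trans lt_mc le_cd) Jm.
  by exists u => //; apply: lepm_trans le_mc.
move=> /Gle[m Gm le_mb]; exists m => //; exists G; split=> //; split=> [f|G' sG' gG' c [Jc Gc]].
  split=> [Jf|[s [Gs ->]]]; last first.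
    by have [_ _ JM] := Jid; apply: ideal_sum => // u /Gs[Ju _]; apply: JM.
  suff gen_sum r : {subset r <= msupp f} ->
      generated_by G (\sum_(c <- r) f@_c *: 'X_[c]) by rewrite [f]mpolyE; apply: gen_sum.
  elim: r => [|c r IHr] sr; first by exists [::]; rewrite !big_nil.
  have [|s [Gs sumE]] := IHr; first by move=> d d_r; apply: sr; rewrite inE d_r orbT.
  have [u Gu le_uc] := Gle c (Jmon f c Jf (sr c (mem_head _ _))).
  exists ((f@_c *: 'X_[c - u], u) :: s); split=> [v|].
    by rewrite inE => /orP[/eqP ->|/Gs].
  by rewrite !big_cons -sumE /= -scalerAl -mpolyXD submK.
have [u Gu le_uc] : exists2 u, G' u & (u <= c)%MM.
  by apply: (@generated_by_msupp G' 'X_[c]); [apply/gG' | rewrite msuppX inE].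
by rewrite -(Gc u) //; case: (sG' u Gu).
Qed.

Lemma minimal_gen_mem J m : minimal_gen J m -> J 'X_[m].
Proof.
case=> G [[GJ _] Gm]; apply/GJ; exists [:: (1, m)].
by split=> [u|]; rewrite ?big_seq1 ?mul1r // inE => /eqP ->.
Qed.

End MonomialIdealTheory.

(** * Degrees and homogeneous operators *)

Section Degrees.
Variables (k : fieldType) (n : nat).
Implicit Types (m b c : 'X_{1..n}) (a : 'rV[int]_n).

Lemma deg_ofD m b : deg_of (m + b)%MM = deg_of m + deg_of b.
Proof. by apply/rowP => i; rewrite !mxE mnmDE. Qed.

Lemma deg_ofU (i : 'I_n) : deg_of U_(i)%MM = ebase i.
Proof. by apply/rowP => j; rewrite !mxE mnm1E eqxx eq_sym; case: eqP. Qed.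

Lemma nonneg_deg m : nonneg (deg_of m).
Proof. by apply/forallP => i; rewrite mxE. Qed.

Lemma mnm_ofK m : mnm_of (deg_of m) = m.
Proof. by apply/mnmP => i; rewrite mnmE mxE. Qed.

Lemma deg_mnm_of a : nonneg a -> deg_of (mnm_of a) = a.
Proof. by move/forallP => a_ge0; apply/rowP => i; rewrite mxE mnmE gez0_abs. Qed.

Lemma deg_of_inj : injective (@deg_of n).
Proof. exact: can_inj mnm_ofK. Qed.

Lemma xpow_deg m : xpow k (deg_of m) = 'X_[m].
Proof. by rewrite /xpow nonneg_deg mnm_ofK. Qed.

Lemma pairing_deg (p : 'rV[k]_n) m : pairing p (deg_of m) = \sum_i p 0 i * (m i)%:R.
Proof. by apply: eq_bigr => i _; rewrite mxE. Qed.

Lemma pairingU (p : 'rV[k]_n) (i : 'I_n) : pairing p (deg_of U_(i)) = p 0 i.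
Proof.
rewrite pairing_deg (bigD1 i) //= mnm1E eqxx mulr1 big1 ?addr0 // => j ne_ji.
by rewrite mnm1E eq_sym (negPf ne_ji) mulr0.
Qed.

Lemma submUK m (i : 'I_n) : (0 < m i)%N -> (m - U_(i) + U_(i))%MM = m.
Proof.
move=> mi_gt0; apply/submK/mnm_lepP => j; rewrite mnm1E.
by case: eqP => // <-.
Qed.

Lemma addmUB m b (i : 'I_n) : (0 < b i)%N -> (m + (b - U_(i)))%MM = (m + b - U_(i))%MM.
Proof. by move=> bi_gt0; rewrite -{2}(submUK bi_gt0) addmA addmK. Qed.

Lemma mnm_neq0P m : m != 0%MM -> exists i, (0 < m i)%N.
Proof.
move=> m_neq0; apply/existsP; apply: contraR m_neq0; rewrite negb_exists.
by move/forallP => m0; apply/eqP/mnmP => i; rewrite mnm0E; case: (m i) (m0 i).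
Qed.

(** Where it is defined, the degree-[a] operator attached to [p] is the vector
    field with coefficients [p_i x^(a + e_i)]; the Leibniz rule, the linearity
    and the brackets are inherited from the partial derivatives. *)
Lemma hderE a (p : 'rV[k]_n) (f : {mpoly k[n]}) : hder_defined a p ->
  hder a p f = \sum_i p 0 i *: (xpow k (a + ebase i) * f^`M(i)).
Proof.
move=> a_def; rewrite {2}[f]mpolyE /hder.
under [RHS]eq_bigr => i _.
  rewrite linear_sum mulr_sumr scaler_sumr.
  over.
rewrite exchange_big /=; apply: eq_bigr => m _.
rewrite pairing_deg mulr_sumr scaler_suml; apply: eq_bigr => i _.
rewrite mderivZ mderivX -!scalerAr !scalerA [f@_m * _]mulrCA.
have [->|mi_gt0] := posnP (m i); first by rewrite !mulr0 !scale0r.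
have [->|pi_neq0] := eqVneq (p 0 i) 0; first by rewrite !mul0r !scale0r.
congr (_ *: _).
have a_i : nonneg (a + ebase i) by rewrite addrC -deg_ofU a_def // pairingU.
rewrite -{1}(submUK mi_gt0) deg_ofD deg_ofU -addrA [ebase i + a]addrC.
by rewrite -(deg_mnm_of a_i) -deg_ofD !xpow_deg mpolyXD mulrC.
Qed.

End Degrees.

(** * Monomial vector fields on the polynomial ring *)

Section Operators.
Variables (k : fieldType) (n : nat).
Implicit Types (F : {mpoly k[n]} -> {mpoly k[n]}) (f g : {mpoly k[n]}).
Implicit Types (m b c : 'X_{1..n}) (i j : 'I_n).

Definition xdiff b i f : {mpoly k[n]} := 'X_[b] * f^`M(i).

Definition poly_derivation F : Prop :=
  linear F /\ forall f g, F (f * g) = F f * g + f * F g.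

Lemma xdiffX b i m : xdiff b i 'X_[m] = (m i)%:R *: 'X_[b + m - U_(i)].
Proof.
rewrite /xdiff mderivX -scalerAr.
have [->|mi_gt0] := posnP (m i); first by rewrite !scale0r.
by rewrite -mpolyXD addmUB.
Qed.

Lemma xdiff_derivation b i : poly_derivation (xdiff b i).
Proof.
split=> [c f g|f g]; first by rewrite /xdiff linearP mulrDr -scalerAr.
by rewrite /xdiff mderivM mulrDr !mulrA [f * _]mulrC.
Qed.

Lemma hder_derivation (a : 'rV[int]_n) (p : 'rV[k]_n) :
  hder_defined a p -> poly_derivation (hder a p).
Proof.
move=> a_def; split=> [c f g|f g]; rewrite !hderE //.
  rewrite scaler_sumr -big_split; apply: eq_bigr => i _ /=.
  by rewrite linearP mulrDr scalerDr -scalerAr !scalerA [c * _]mulrC.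
rewrite mulr_suml mulr_sumr -big_split; apply: eq_bigr => i _ /=.
rewrite mderivM mulrDr scalerDr -scalerAl -scalerAr !mulrA.
by rewrite [f * _]mulrC.
Qed.

(** The second-order parts cancel because partial derivatives commute. When
    [b i] is zero the truncated exponent [a + b - U_(i)] is meaningless, but so
    is its term, whose coefficient vanishes; likewise for [a j]. *)
Lemma xdiff_bracket a b i j f :
  xdiff a i (xdiff b j f) - xdiff b j (xdiff a i f) =
    (b i)%:R *: xdiff (a + b - U_(i))%MM j f - (a j)%:R *: xdiff (a + b - U_(j))%MM i f.
Proof.
rewrite /xdiff /xdiff !mderivM !mulrDr !mulrA -!/(xdiff _ _ _) !xdiffX.
rewrite mderiv_comm [(b + a)%MM]addmC -!mpolyXD !mpolyXD ['X_[b] * 'X_[a]]mulrC.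
by rewrite !scalerAl opprD addrACA subrr addr0.
Qed.

Lemma hder_deg a b (p : 'rV[k]_n) i f : hder_defined a p ->
  (forall j, j != i -> p 0 j = 0) -> a + ebase i = deg_of b ->
  hder a p f = p 0 i *: xdiff b i f.
Proof.
move=> a_def p_i a_i; rewrite hderE // (bigD1 i) //= big1 ?addr0.
  by rewrite a_i xpow_deg.
by move=> j /p_i ->; rewrite scale0r.
Qed.

End Operators.

(** * Monomial vector fields preserving the ideal *)

Section CofiniteMonomialIdeals.
Variables (k : fieldType) (n : nat) (I : idealr {mpoly k[n]}).
Hypothesis char0 : [pchar k] =i pred0.
Hypothesis Imon : is_monomial_ideal (fun f => f \in I).
Implicit Types (f g : {mpoly k[n]}) (m b c : 'X_{1..n}) (i j l : 'I_n).

Definition preserving b i : Prop := forall f, f \in I -> xdiff b i f \in I.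

Lemma char0_natr_neq0 e : (0 < e)%N -> e%:R != 0 :> k.
Proof. by rewrite (pcharf0P k).1 // lt0n. Qed.

Lemma idealZ (e : k) f : f \in I -> e *: f \in I.
Proof. by rewrite -mul_mpolyC; apply: idealMr. Qed.

Lemma idealZ_inv (e : k) f : e != 0 -> e *: f \in I -> f \in I.
Proof. by move=> e0 /(idealZ e^-1); rewrite scalerA mulVf // scale1r. Qed.

Lemma Iideal : is_ideal (fun f => f \in I).
Proof.
by split=> [|f g fI gI|f g]; [exact: rpred0 | exact: rpredD | exact: idealMr].
Qed.

Lemma msupp_mem f m : f \in I -> m \in msupp f -> 'X_[m] \in I.
Proof. exact: monomial_ideal_closed Imon _ _. Qed.

(** In characteristic zero the coefficient [m i] of
    [x^b d_i (x^m) = m_i x^(b + m - e_i)] is invertible, so preservation is a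
    condition on exponents alone. *)
Lemma preservingP b i : preserving b i <->
  forall m, 'X_[m] \in I -> (0 < m i)%N -> 'X_[b + m - U_(i)] \in I.
Proof.
split=> [pres_b m mI mi_gt0|shift_b f fI].
  by apply: (idealZ_inv (char0_natr_neq0 mi_gt0)); rewrite -xdiffX; apply: pres_b.
have [linX _] := xdiff_derivation k b i.
rewrite [f]mpolyE /xdiff linear_sum mulr_sumr.
apply: ideal_sum Iideal _ => m m_f; rewrite /= mderivZ -scalerAr -/(xdiff b i _) xdiffX.
apply: idealZ; have [->|mi_gt0] := posnP (m i); first by rewrite scale0r rpred0.
exact/idealZ/shift_b/mi_gt0/(msupp_mem fI).
Qed.

Lemma preserving_inner b i : (0 < b i)%N -> preserving b i.
Proof.
move=> bi_gt0; apply/preservingP => m mI _.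
by rewrite addmC -addmUB // addmC mpolyXD; apply: idealMr.
Qed.

(** Both sides say that [x^(c + e_i)] in [I] forces [x^(b + c)] in [I]; on the
    right, [c] runs over the monomials of [I : (x_i)]. *)
Lemma preserving_Jideal b i : preserving b i <-> Jideal I i 'X_[b].
Proof.
split=> [/preservingP shift_b g gX|Jb].
  rewrite [g]mpolyE mulr_sumr; apply: ideal_sum Iideal _ => c c_g.
  rewrite -scalerAr -mpolyXD; apply: idealZ.
  rewrite -[(b + c)%MM](addmK U_(i)) -addmA; apply: shift_b.
    apply: (@msupp_mem (g * 'X_i)); first by apply: gX; exists 1; rewrite mul1r.
    by rewrite (perm_mem (msuppMX _ _)) addmC map_f.
  by rewrite mnmDE mnm1E eqxx addn1.
apply/preservingP => m mI mi_gt0; rewrite -addmUB // mpolyXD.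
apply: Jb => _ [h ->]; rewrite mulrCA -mpolyXD submUK //; exact: idealMr.
Qed.

Lemma Jideal_ideal i : is_ideal (Jideal I i).
Proof. exact/ideal_colon/Iideal. Qed.

Lemma Jideal_monomial_closed i : monomial_closed (Jideal I i).
Proof.
have Icl : monomial_closed (fun f => f \in I) by exact: monomial_ideal_closed.
apply: (colon_monomial_closed Iideal Icl).
exact: colon_monomial_closed Iideal Icl (@principal_monomial_closed _ _ _).
Qed.

(** If [d_i] preserved [I], differentiating a power of [x_i] in [I], which
    exists by cofiniteness, would descend to [1] in [I]. *)
Lemma not_preserving0 i : cofinite_support I -> ~ preserving 0%MM i.
Proof.
case=> s s_cof /preservingP shift0.
have powN e : 'X_[U_(i) *+ e] \notin I.
  elim: e => [|e IHe]; first by rewrite mulm0n mpolyX0 idealr1.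
  apply: contra IHe => /shift0; rewrite add0m mulmSr addmK; apply.
  by rewrite mnmDE mnm1E eqxx addn1.
have big_s := s_cof _ (powN (\max_(m <- s) mdeg m).+1).
have := leq_bigmax_seq (P := xpredT) (F := fun m => mdeg m) _ big_s isT.
by rewrite mdegMn mdeg1 mul1n ltnn.
Qed.

End CofiniteMonomialIdeals.

(** * Derivations and Lie subalgebras *)

Section DerivationAlgebra.
Variables (k : comNzRingType) (A : comAlgType k).
Implicit Types (D : A -> A) (L S : (A -> A) -> Prop).

Lemma derivation0 D : derivation D -> D 0 = 0.
Proof. by case=> linD _; have := linD (-1) 0 0; rewrite !scaleN1r oppr0 addr0 addNr. Qed.

Lemma derivation1 D : derivation D -> D 1 = 0.
Proof.
case=> _ prodD; apply: (@addIr _ (D 1)); rewrite add0r.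
by have := prodD 1 1; rewrite !(mulr1, mul1r).
Qed.

Lemma lie_eq L D D' : lie_subalgebra L -> D =1 D' -> L D -> L D'.
Proof. by case=> [[Leq _ _] _]; apply: Leq. Qed.

Lemma lie0 L : lie_subalgebra L -> L (fun=> 0).
Proof. by case=> [[_ L0 _] _]. Qed.

Lemma lie_lin L (c : k) D D' : lie_subalgebra L ->
  L D -> L D' -> L (fun a => c *: D a + D' a).
Proof. by case=> [[_ _ Llin] _]; apply: Llin. Qed.

Lemma lie_mem_bracket L D D' : lie_subalgebra L ->
  L D -> L D' -> L (lie_bracket D D').
Proof. by case=> [_ Lbr]; apply: Lbr. Qed.

Lemma lie_span L S D : lie_subalgebra L ->
  (forall D', S D' -> L D') -> linear_span S D -> L D.
Proof. by case=> Lsub _ SL; apply. Qed.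

Lemma derivation_lie_subalgebra : lie_subalgebra (@derivation k A).
Proof.
split; first split.
- move=> D D' DE [linD prodD]; split=> [c a b|a b]; rewrite -!DE; last exact: prodD.
  exact: linD.
- by split=> [c a b|a b]; rewrite ?scaler0 ?mul0r ?mulr0 addr0.
- move=> e D D' [linD prodD] [linD' prodD']; split=> [c a b|a b].
    rewrite linD linD' !scalerDr addrACA !scalerA.
    by rewrite [c * e]mulrC.
  rewrite prodD prodD' scalerDr mulrDl mulrDr -!scalerAl -!scalerAr.
  by rewrite addrACA.
move=> D D' [linD prodD] [linD' prodD']; split=> [c a b|a b]; rewrite /lie_bracket.
  rewrite linD' linD linD linD' scalerBr opprD.
  by rewrite addrACA.
have DD x y : D (x + y) = D x + D y by have := linD 1 x y; rewrite !scale1r.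
have D'D x y : D' (x + y) = D' x + D' y by have := linD' 1 x y; rewrite !scale1r.
rewrite prodD' prodD DD D'D !prodD !prodD'.
by ring.
Qed.

End DerivationAlgebra.

(** * Operators inducing elements of a Lie subalgebra *)

(** The quotient is represented by any algebra [A] with a surjection [pi] of
    kernel [I] and a set-theoretic section [rep]: nothing below depends on a
    choice of coset representatives. *)

Section Quotients.
Variables (k : fieldType) (n : nat) (I : idealr {mpoly k[n]}) (A : comAlgType k).
Variables (pi : {lrmorphism {mpoly k[n]} -> A}) (rep : A -> {mpoly k[n]}).
Hypothesis repK : cancel rep pi.
Hypothesis ker_pi : forall f, pi f = 0 <-> f \in I.
Implicit Types (F : {mpoly k[n]} -> {mpoly k[n]}) (f g : {mpoly k[n]}).
Implicit Types (m b c : 'X_{1..n}) (i j l : 'I_n) (D : A -> A).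

Lemma pi_eq f g : pi f = pi g <-> f - g \in I.
Proof.
rewrite -ker_pi rmorphB /=; split=> [->|/eqP]; first by rewrite subrr.
by rewrite subr_eq0 => /eqP.
Qed.

Definition lifts D F : Prop := forall f, D (pi f) = pi (F f).

Definition induced F : A -> A := fun a => pi (F (rep a)).

Lemma lifts_induced F : linear F -> (forall f, f \in I -> F f \in I) ->
  lifts (induced F) F.
Proof.
move=> linF IF f; apply/pi_eq.
have -> : F (rep (pi f)) - F f = F (- 1 *: f + rep (pi f)).
  by rewrite linF scaleN1r addrC.
by apply: IF; rewrite scaleN1r addrC; apply/pi_eq; rewrite repK.
Qed.

Lemma lifts_derivation D F : lifts D F -> poly_derivation F -> derivation D.
Proof.
move=> DF [linF prodF]; split=> [c a b|a b]; rewrite -[a]repK -[b]repK.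
  by rewrite -linearP !DF linF linearP.
by rewrite -rmorphM !DF prodF rmorphD !rmorphM.
Qed.

(** The chain rule: a derivation of the quotient is determined by its values on
    the variables. *)
Lemma derivation_chain D f : derivation D ->
  D (pi f) = \sum_i pi f^`M(i) * D (pi 'X_i).
Proof.
move=> derD; have [linD prodD] := derD.
elim/mpolyind: f => [|c m p _ _ IHp].
  rewrite rmorph0 derivation0 // big1 // => i _.
  by rewrite mderiv0 rmorph0 mul0r.
rewrite linearP linD IHp.
under [RHS]eq_bigr do rewrite mderivD mderivZ linearP mulrDl -scalerAl.
rewrite big_split /= -scaler_sumr; congr (c *: _ + _).
have [d] := ubnP (mdeg m); elim: d m => // d IHd m.
have [-> _|/mnm_neq0P[j mj_gt0]] := eqVneq m 0%MM.
  rewrite mpolyX0 rmorph1 derivation1 // big1 // => i _.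
  by rewrite -mpolyC1 mderivC rmorph0 mul0r.
rewrite -(submUK mj_gt0) mdegD mdeg1 addn1 ltnS => /IHd IHm.
rewrite mpolyXD rmorphM prodD IHm mulr_suml.
under [RHS]eq_bigr do rewrite mderivM rmorphD !rmorphM mulrDl.
rewrite big_split; congr (_ + _); first by apply: eq_bigr => i _; rewrite mulrAC.
rewrite /= (bigD1 j) //= big1 => [|i ne_ij].
  have -> : 'X_j^`M(j) = 1 :> {mpoly k[n]}.
    rewrite mderivX mnm1E eqxx scale1r -mpolyX0; congr 'X_[_].
    by apply/mnmP => l; rewrite mnmBE mnm0E subnn.
  by rewrite rmorph1 mulr1 addr0.
by rewrite mderivX mnm1E eq_sym (negPf ne_ij) scale0r rmorph0 mulr0 mul0r.
Qed.

(** Such a [D] is a nonzero multiple of the map induced by [x^c d_i], and the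
    existence of [D] forces that operator to respect the kernel of [pi]. *)
Lemma derivation_preserving D (e : k) c i x : derivation D -> D x != 0 ->
    (forall l, l != i -> D (pi 'X_l) = 0) -> D (pi 'X_i) = e *: pi 'X_[c] ->
  preserving I c i.
Proof.
move=> derD Dx_neq0 D0 Di.
have Df f : D (pi f) = e *: pi (xdiff c i f).
  rewrite derivation_chain // (bigD1 i) //= Di big1 ?addr0 => [|l /D0 ->].
    by rewrite -scalerAr -rmorphM mulrC.
  by rewrite mulr0.
have e_neq0 : e != 0.
  by apply: contraNneq Dx_neq0 => e0; rewrite -[x]repK Df e0 scale0r.
move=> f fI; apply/ker_pi; apply: (scalerI e_neq0).
by rewrite -Df scaler0 (ker_pi f).2 // derivation0.
Qed.

Lemma derivation_eq0 D : derivation D -> (forall i, D (pi 'X_i) = 0) ->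
  forall x, D x = 0.
Proof.
move=> derD D0 x; rewrite -[x]repK derivation_chain // big1 // => i _.
by rewrite D0 mulr0.
Qed.

Hypothesis char0 : [pchar k] =i pred0.
Hypothesis Imon : is_monomial_ideal (fun f => f \in I).
Variable L : (A -> A) -> Prop.
Hypothesis Llie : lie_subalgebra L.

(** Keeping the map [D] existential makes brackets and linear combinations of
    operators immediate, without checking each time that an operator descends
    to the quotient. *)
Definition lifted F : Prop := exists2 D, L D & lifts D F.

Lemma lifted_mod F F' : (forall f, F' f - F f \in I) -> lifted F -> lifted F'.
Proof.
move=> eqF [D LD DF]; exists D => // f; rewrite DF.
by apply/esym/pi_eq.
Qed.

Lemma lifted_eq F F' : F' =1 F -> lifted F -> lifted F'.
Proof. by move=> eqF [D LD DF]; exists D => // f; rewrite DF eqF. Qed.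

Lemma lifted_lin (e : k) F F' :
  lifted F -> lifted F' -> lifted (fun f => e *: F f + F' f).
Proof.
move=> [D LD DF] [D' LD' DF'].
exists (fun a => e *: D a + D' a); first exact: lie_lin.
by move=> f; rewrite linearP DF DF'.
Qed.

Lemma lifted0 : lifted (fun=> 0).
Proof.
exists (fun=> 0) => [|f]; first exact: lie0.
by rewrite rmorph0.
Qed.

Lemma liftedZ (e : k) F : lifted F -> lifted (fun f => e *: F f).
Proof.
move=> LF; apply: (lifted_eq _ (lifted_lin e LF lifted0)) => f.
by rewrite addr0.
Qed.

Lemma liftedD F F' : lifted F -> lifted F' -> lifted (fun f => F f + F' f).
Proof.
move=> LF LF'; apply: (lifted_eq _ (lifted_lin 1 LF LF')) => f.
by rewrite scale1r.
Qed.

Lemma liftedZ_inv (e : k) F : e != 0 -> lifted (fun f => e *: F f) -> lifted F.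
Proof.
move=> e0 /(liftedZ e^-1); apply: lifted_eq => f.
by rewrite scalerA mulVf // scale1r.
Qed.

Lemma lifted_sum (T : eqType) (r : seq T) (F : T -> {mpoly k[n]} -> {mpoly k[n]}) :
  (forall x, x \in r -> lifted (F x)) -> lifted (fun f => \sum_(x <- r) F x f).
Proof.
elim: r => [|x r IHr] LF.
  by apply: lifted_eq lifted0 => f; rewrite big_nil.
apply: (lifted_eq (fun f => big_cons _ _ _ _ _ _)); apply: liftedD.
  exact/LF/mem_head.
by apply: IHr => y y_r; apply: LF; rewrite inE y_r orbT.
Qed.

Lemma lifted_mem D F : lifted F -> lifts D F -> L D.
Proof.
move=> [D' LD' D'F] DF; apply: (lie_eq Llie _ LD') => a.
by rewrite -[a]repK DF D'F.
Qed.

Lemma lifted_xdiff_mem b i : 'X_[b] \in I -> lifted (xdiff b i).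
Proof.
move=> bI; apply: lifted_mod lifted0 => f.
by rewrite subr0 /xdiff mulrC; apply: idealMr.
Qed.

Lemma lifted_xdiff_bracket a b i j :
  lifted (xdiff a i) -> lifted (xdiff b j) ->
  lifted (fun f => (b i)%:R *: xdiff (a + b - U_(i))%MM j f
                   - (a j)%:R *: xdiff (a + b - U_(j))%MM i f).
Proof.
move=> [D LD DF] [D' LD' DF'].
exists (lie_bracket D D'); first exact: lie_mem_bracket.
by move=> f; rewrite /lie_bracket DF' DF DF DF' -rmorphB xdiff_bracket.
Qed.

(** This is [[x^a H_i, x^b H_j] = b_i x^(a+b) H_j - a_j x^(a+b) H_i]. When
    [i = j], the contributions of the exponents [U_(i)] and [U_(j)] to the two
    coefficients cancel. *)
Lemma lifted_inner_bracket a b i j :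
  lifted (xdiff (a + U_(i))%MM i) -> lifted (xdiff (b + U_(j))%MM j) ->
  lifted (fun f => (b i)%:R *: xdiff (a + b + U_(j))%MM j f
                   - (a j)%:R *: xdiff (a + b + U_(i))%MM i f).
Proof.
move=> La Lb; apply: lifted_eq (lifted_xdiff_bracket La Lb) => f.
have -> : (a + U_(i) + (b + U_(j)) - U_(i) = a + b + U_(j))%MM.
  by rewrite -[(a + U_(i))%MM]addmC -addmA [(U_(i) + _)%MM]addmC addmK addmA.
have -> : (a + U_(i) + (b + U_(j)) - U_(j) = a + b + U_(i))%MM.
  by rewrite addmA addmK -!addmA [(U_(i) + b)%MM]addmC.
rewrite !mnmDE !mnm1E [i == j]eq_sym.
have [-> |_] := eqVneq j i; last by rewrite !addn0.
by rewrite !natrD !scalerDl opprD addrACA subrr addr0.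
Qed.

(** Split off one variable, [a = e_i + c]. If some [i != j] is available, then
    [[x_i H_j, x^c H_j] = c_j x^a H_j] when [c_j] is nonzero, and
    [[x_i H_j, x^c H_i] = - x^a H_j] when it is zero. Otherwise [a] is a
    multiple [r e_j], and [[x_j H_j, x^c H_j] = (r - 2) x^a H_j]; the excluded
    case is [r = 2]. *)
Lemma lifted_inner_step a j :
    (1 < mdeg a)%N -> a != (U_(j) *+ 2)%MM ->
    (forall b i, (mdeg b < mdeg a)%N -> b != 0%MM ->
       lifted (xdiff (b + U_(i))%MM i)) ->
  lifted (xdiff (a + U_(j))%MM j).
Proof.
move=> a_gt1 a_neq IHa.
have step i : (0 < a i)%N ->
    [/\ forall l, lifted (xdiff (U_(i) + U_(l))%MM l),
        forall l, lifted (xdiff (a - U_(i) + U_(l))%MM l) &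
        (U_(i) + (a - U_(i)) = a)%MM].
  move=> /submUK aE; have degE : mdeg a = (mdeg (a - U_(i))).+1.
    by rewrite -{1}aE mdegD mdeg1 addn1.
  split=> [l|l|]; last by rewrite addmC.
    by apply: IHa; rewrite ?mdeg1 // mnm1_eq0.
  apply: IHa; first by rewrite degE.
  by rewrite -mdeg_eq0 -lt0n -ltnS -degE.
have [[i ne_ij ai_gt0]|a_j] := classic (exists2 i, i != j & (0 < a i)%N).
  have [Li La aE] := step i ai_gt0.
  have [aj0|aj_gt0] := posnP ((a - U_(i))%MM j).
    apply: (@liftedZ_inv (-1)); first by rewrite oppr_eq0 oner_eq0.
    apply: lifted_eq (lifted_inner_bracket (Li j) (La i)) => f.
    by rewrite aj0 scale0r sub0r mnm1E eqxx scaleN1r scale1r aE.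
  apply: (liftedZ_inv (char0_natr_neq0 char0 aj_gt0)).
  apply: lifted_eq (lifted_inner_bracket (Li j) (La j)) => f.
  by rewrite mnm1E (negPf ne_ij) scale0r subr0 aE.
have aE : a = (U_(j) *+ a j)%MM.
  apply/mnmP => i; rewrite mulmnE mnm1E; have [<-|ne_ji] := eqVneq j i.
    by rewrite mul1n.
  rewrite mul0n; apply/eqP; rewrite -leqn0 leqNgt; apply/negP => ai_gt0.
  by case: a_j; exists i; rewrite 1?eq_sym.
have aj_gt2 : (2 < a j)%N.
  rewrite ltn_neqAle; apply/andP; split.
    by apply: contraNneq a_neq => ->; rewrite {1}aE.
  by rewrite aE mdegMn mdeg1 mul1n in a_gt1.
have [|Lj La aUE] := step j; first exact: ltn_trans aj_gt2.
have c_gt0 : (0 < a j - 2)%N by rewrite subn_gt0.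
apply: (liftedZ_inv (char0_natr_neq0 char0 c_gt0)).
apply: lifted_eq (lifted_inner_bracket (Lj j) (La j)) => f.
by rewrite mnmBE !mnm1E eqxx aUE -scalerBl -natrB -?subnDA // subn_gt0 ltnW.
Qed.

(** [D] lifts to [F = sum_j v_j d_j], which preserves [I], and the point is that
    each monomial term of [F] does too. A term [x^m d_i] with [m_i = 0] is
    isolated as follows: in [F (x^b)] the monomial [x^(m + b - e_i)] has
    exponent [b_i - 1] at [i], while all monomials coming from [v_j d_j] with
    [j != i] have exponent at least [b_i] there. So its coefficient is [b_i]
    times that of [x^m] in [v_i], and it lies in [I] because [F (x^b)] does. *)
Lemma derivation_lifted D :
    (forall b i, preserving I b i -> lifted (xdiff b i)) -> derivation D -> L D.
Proof.
move=> Lpres derD; pose v i := rep (D (pi 'X_i)).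
pose F f := \sum_i v i * f^`M(i).
have DF : lifts D F.
  move=> f; rewrite derivation_chain // rmorph_sum; apply: eq_bigr => i _ /=.
  by rewrite rmorphM /= repK mulrC.
have IF f : f \in I -> F f \in I.
  by move=> fI; apply/ker_pi; rewrite -DF (ker_pi f).2 // derivation0.
have pres_v i m : m \in msupp (v i) -> preserving I m i.
  move=> m_v; have [mi0|] := posnP (m i); last exact: (preserving_inner char0 Imon).
  apply/(preservingP char0 Imon) => b bI bi_gt0.
  apply: (msupp_mem Imon (IF _ bI)); rewrite mcoeff_msupp /F raddf_sum /=.
  rewrite (bigD1 i) //= big1 ?addr0 => [|j ne_ji].
    rewrite mderivX -scalerAr mcoeffZ -addmUB // addmC mcoeffMX mulf_neq0 //.
      exact: char0_natr_neq0.
    by rewrite -mcoeff_msupp.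
  apply/eqP; rewrite mderivX -scalerAr mcoeffZ mulf_eq0 mcoeff_eq0; apply/orP; right.
  rewrite (perm_mem (msuppMX _ _)); apply/mapP => -[c _] /mnmP/(_ i).
  rewrite !(mnmDE, mnmBE) !mnm1E eqxx (negPf ne_ji) mi0 subn0 add0n => bE.
  by have := ltn_subrL 1 (b i); rewrite bi_gt0 bE ltnNge leq_addr.
have LF : lifted F.
  apply: lifted_sum => i _.
  suff Fi f : v i * f^`M(i) = \sum_(m <- msupp (v i)) (v i)@_m *: xdiff m i f.
    apply: (lifted_eq Fi); apply: lifted_sum => m m_v.
    exact/liftedZ/Lpres/pres_v.
  rewrite {1}[v i]mpolyE mulr_suml; apply: eq_bigr => m _.
  by rewrite -scalerAl.
exact: lifted_mem LF DF.
Qed.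

End Quotients.

(** * Roots and root spaces of the quotient *)

Section RootSpaces.
Variables (k : fieldType) (n : nat) (I : idealr {mpoly k[n]}).
Local Notation A := ({ideal_quot I}).
Implicit Types (f g : {mpoly k[n]}) (a : 'rV[int]_n).
Implicit Types (m b c : 'X_{1..n}) (i j l : 'I_n) (D : A -> A).

HB.instance Definition _ := GRing.isScalable.Build k {mpoly k[n]} A *:%R \pi_A
  (@pi_scale _ _ I).

Definition quot_pi : {lrmorphism {mpoly k[n]} -> A} := \pi_A.

Lemma quot_repK : cancel repr quot_pi.
Proof. exact: reprK. Qed.

Lemma quot_ker f : quot_pi f = 0 <-> f \in I.
Proof.
rewrite -[f in _ <-> f \in _]subr0 Quotient.idealrBE; split=> [f0|/eqP f0].
  by apply/eqP; apply: etrans f0 (esym (rmorph0 quot_pi)).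
exact: etrans f0 (rmorph0 quot_pi).
Qed.

Definition quot_xdiff b i : A -> A := induced quot_pi repr (xdiff b i).

Lemma induced_hder_derivation a (p : 'rV[k]_n) D :
  is_induced_hder a p D -> derivation D.
Proof.
case=> a_def _ D_hder; have Dlifts : lifts quot_pi D (hder a p) by [].
exact: (lifts_derivation quot_repK Dlifts (hder_derivation a_def)).
Qed.

Lemma lifts_quot_xdiff b i : preserving I b i ->
  lifts quot_pi (quot_xdiff b i) (xdiff b i).
Proof.
have [linX _] := xdiff_derivation k b i.
exact: (lifts_induced quot_repK quot_ker).
Qed.

(** The witness is the map induced by [x^b d_i]; it is nonzero because it sends
    [x_i] to [x^b]. *)
Lemma xdiff_root b i : preserving I b i -> 'X_[b] \notin I -> b != U_(i)%MM ->
  is_root I (deg_of b - ebase i).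
Proof.
move=> pres_b bNI ne_bi; split.
  by rewrite subr_eq0 -deg_ofU (inj_eq (@deg_of_inj _)).
have DX := lifts_quot_xdiff pres_b; exists (quot_xdiff b i); split.
- exact: (lifts_derivation quot_repK DX (xdiff_derivation k b i)).
- move=> m; exists (m i)%:R; apply: etrans (DX 'X_[m]) _.
  rewrite xdiffX linearZ /= -/(quot_pi _).
  have [->|mi_gt0] := posnP (m i); first by rewrite !scale0r.
  have -> : deg_of m + (deg_of b - ebase i) = deg_of (b + (m - U_(i)))%MM.
    rewrite -{1}(submUK mi_gt0) !deg_ofD deg_ofU addrACA [RHS]addrC.
    by rewrite [ebase i - _]subrr addr0.
  by rewrite xpow_deg addmUB.
- exists (quot_pi 'X_i); rewrite DX xdiffX mnm1E eqxx scale1r addmK.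
  by apply/eqP => /quot_ker; apply/negP.
Qed.

(** A nonzero derivation is nonzero on some variable [x_i], whose image has
    degree [a + e_i]. *)
Lemma root_degree (a : 'rV[int]_n) : is_root I a ->
  exists i c, a + ebase i = deg_of c.
Proof.
case=> _ [D [derD homD [x Dx_neq0]]]; apply: NNPP => Na.
case/eqP: Dx_neq0; apply: (derivation_eq0 quot_repK derD) => i.
have [e De] := homD U_(i)%MM; apply: etrans De _.
rewrite deg_ofU addrC /xpow ifF; first by rewrite -/(quot_pi 0) rmorph0 scaler0.
apply/negP => /deg_mnm_of a_i; case: Na.
by exists i, (mnm_of (a + ebase i)).
Qed.

(** In degree [c - e_i] with [c_i = 0], the image of a variable other than
    [x_i] would have exponent [-1] at [i], so a derivation of this degree kills
    all variables but [x_i]. *)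
Lemma root_preserving i c : c i = 0%N ->
  is_root I (deg_of c - ebase i) -> preserving I c i.
Proof.
move=> ci0 [_ [D [derD homD [x Dx_neq0]]]].
have [e De] := homD U_(i)%MM.
apply: (derivation_preserving quot_repK quot_ker derD Dx_neq0 (e := e)).
  move=> l ne_li; have [e' De'] := homD U_(l)%MM; apply: etrans De' _.
  rewrite /xpow ifF; first by rewrite -/(quot_pi 0) rmorph0 scaler0.
  apply/negP => /forallP/(_ i).
  by rewrite !mxE mnm1E !eqxx (negPf ne_li) ci0.
apply: etrans De _.
by rewrite deg_ofU addrC subrK xpow_deg.
Qed.

Lemma shift_inner (a : 'rV[int]_n) b i :
  a + ebase i = deg_of b -> (0 < b i)%N -> a = deg_of (b - U_(i))%MM.
Proof.
move=> a_i /submUK bE; apply: (addIr (ebase i)).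
by rewrite a_i -deg_ofU -deg_ofD bE.
Qed.

Lemma shift_outer (a : 'rV[int]_n) b i :
  a + ebase i = deg_of b -> b i = 0%N -> a 0 i = -1.
Proof.
move=> /rowP/(_ i) + bi0; rewrite !mxE !eqxx bi0 => /eqP.
by rewrite addr_eq0 => /eqP.
Qed.

(** The parameter is the dual basis vector [e_i^*]. If [a] has a negative
    coordinate then [b_i = 0] and [a_i = -1], which is the outer case of
    [Nspace]. *)
Lemma root_space_xdiff (a : 'rV[int]_n) b i :
    a + ebase i = deg_of b -> 'X_[b] \notin I -> preserving I b i ->
  root_space a (quot_xdiff b i).
Proof.
move=> a_i bNI pres_b.
have p_i j : j != i -> (delta_mx 0 i : 'rV[k]_n) 0 j = 0.
  by move=> ne_ji; rewrite mxE (negPf ne_ji).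
have a_def : hder_defined a (delta_mx 0 i : 'rV[k]_n).
  move=> m; rewrite pairing_deg (bigD1 i) //= big1 ?addr0 => [|j /p_i ->].
    rewrite mxE !eqxx mul1r; have [-> /eqP//|mi_gt0 _] := posnP (m i).
    rewrite -(submUK mi_gt0) deg_ofD deg_ofU -addrA [_ + a]addrC a_i -deg_ofD.
    exact: nonneg_deg.
  by rewrite mul0r.
have hderX f : hder a (delta_mx 0 i : 'rV[k]_n) f = xdiff b i f.
  by rewrite (hder_deg _ a_def p_i a_i) mxE !eqxx scale1r.
exists (delta_mx 0 i); last first.
  split=> // f; first by rewrite hderX; apply: pres_b.
  by rewrite hderX; apply: lifts_quot_xdiff.
rewrite /Nspace; case: ifPn => [a_ge0 j jNE|aN].
  apply: p_i; apply: contra jNE => /eqP ->.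
  by rewrite inE a_i nonneg_deg mnm_ofK.
have [bi0|bi_gt0] := posnP (b i).
  by exists i; [apply: shift_outer a_i _ | exact: p_i].
by rewrite (shift_inner a_i bi_gt0) nonneg_deg in aN.
Qed.

Hypothesis char0 : [pchar k] =i pred0.
Hypothesis Imon : is_monomial_ideal (fun f => f \in I).
Variable L : (A -> A) -> Prop.
Hypothesis Llie : lie_subalgebra L.
Local Notation lifted := (lifted quot_pi L).

(** When [x^b] is in [I] the field [x^b d_i] induces zero, so that membership
    in the root space is only needed when [x^b] survives. *)
Lemma lifted_root a b i :
    (forall D, root_space a D -> L D) -> a + ebase i = deg_of b ->
  preserving I b i -> lifted (xdiff b i).
Proof.
move=> rootL a_i pres_b; have [bI|bNI] := boolP ('X_[b] \in I).
  exact: (lifted_xdiff_mem quot_ker Llie).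
exists (quot_xdiff b i); first exact/rootL/root_space_xdiff.
exact: lifts_quot_xdiff.
Qed.

(** The converse passage: an element of [g_a] is a combination of the fields
    [x^(a + e_i) d_i]. Each one occurring preserves [I]: automatically in the
    inner case, and in the outer case because it is the only one. *)
Lemma root_space_lifted a D : root_space a D ->
    (forall b i, a + ebase i = deg_of b -> preserving I b i -> lifted (xdiff b i)) ->
  L D.
Proof.
case=> p Np [a_def pres_a DF] La; apply: (lifted_mem quot_repK Llie) DF.
apply: (lifted_eq (fun f => hderE f a_def)); apply: (lifted_sum Llie) => i _.
have [->|pi_neq0] := eqVneq (p 0 i) 0.
  by apply: (lifted_eq _ (lifted0 _ Llie)) => f; rewrite scale0r.
have a_i : a + ebase i = deg_of (mnm_of (a + ebase i)).
  by rewrite deg_mnm_of // addrC -deg_ofU a_def // pairingU.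
move: (mnm_of _) a_i => b a_i; apply: (liftedZ Llie).
rewrite a_i xpow_deg; apply: (La b i a_i).
have [bi0|] := posnP (b i); last exact: (preserving_inner char0 Imon).
have ai := shift_outer a_i bi0.
have aN : nonneg a = false by apply/negP => /forallP/(_ i); rewrite ai.
move: Np; rewrite /Nspace aN => -[l al p_l].
have il : i = l by apply: contraNeq pi_neq0 => /p_l ->.
rewrite -il in p_l => f fI; apply: (idealZ_inv pi_neq0).
by rewrite -(hder_deg _ a_def p_l a_i); apply: pres_a.
Qed.

End RootSpaces.

(** * Generation by the prescribed root spaces *)

Section Generation.
Variables (k : fieldType) (n : nat) (I : idealr {mpoly k[n]}).
Hypothesis char0 : [pchar k] =i pred0.
Hypothesis Imon : is_monomial_ideal (fun f => f \in I).
Hypothesis Icof : cofinite_support I.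
Local Notation A := ({ideal_quot I}).
Variables (Emin : {set 'I_n}) (L : (A -> A) -> Prop).
Hypothesis EminP : is_minimal_roots I Emin.
Hypothesis Llie : lie_subalgebra L.
Hypothesis Ltorus : forall D, torus D -> L D.
Hypothesis LGtilde : forall a D, Gtilde I a -> root_space a D -> L D.
Hypothesis LEmin : forall i D, i \in Emin -> root_space (ebase i) D -> L D.
Hypothesis Lirr : forall i D, irreducible_root I (ebase i *+ 2) ->
  root_space (ebase i *+ 2) D -> L D.
Local Notation kerI := (@quot_ker k n I).
Local Notation lifted := (lifted (quot_pi I) L).
Implicit Types (f g : {mpoly k[n]}) (m b c : 'X_{1..n}) (i j l : 'I_n).

Lemma lifted_minimal_gen m i :
  minimal_gen (Jideal I i) m -> m i = 0%N -> lifted (xdiff m i).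
Proof.
move=> gen_m mi0; have [mI|mNI] := boolP ('X_[m] \in I).
  exact: (lifted_xdiff_mem kerI Llie).
apply: (lifted_root Llie (a := deg_of m - ebase i)).
- by move=> D; apply: LGtilde; exists i, m; split.
- by rewrite subrK.
- apply/(preserving_Jideal char0 Imon); exact: minimal_gen_mem.
Qed.

(** The monomial [x_j] is a minimal generator of [J_i], its only other divisor
    being [1], which is not in [J_i]. *)
Lemma lifted_shift i j : j != i -> preserving I U_(j)%MM i ->
  lifted (xdiff U_(j)%MM i).
Proof.
move=> ne_ji /(preserving_Jideal char0 Imon) Jj.
have [m gen_m /mnm_lepP le_mj] :=
  minimal_gen_le (Jideal_ideal I i) (Jideal_monomial_closed Imon (i := i)) Jj.
have m0 l : l != j -> m l = 0%N.
  move=> ne_lj; have := le_mj l; rewrite mnm1E eq_sym (negPf ne_lj).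
  by rewrite leqn0 => /eqP.
suff <- : m = U_(j)%MM by apply: lifted_minimal_gen => //; rewrite m0 // eq_sym.
apply/mnmP => l; rewrite mnm1E; have [<-|ne_jl] := eqVneq j l; last first.
  by rewrite m0 // eq_sym.
apply/eqP; rewrite eqn_leq; apply/andP; split.
  by have := le_mj j; rewrite mnm1E eqxx.
rewrite lt0n; apply/negP => /eqP mj0; apply: (@not_preserving0 _ _ I char0 Imon i) => //.
apply/(preserving_Jideal char0 Imon).
suff <- : m = 0%MM by apply: minimal_gen_mem.
by apply/mnmP => r; rewrite mnm0E; have [->|/m0] := eqVneq r j.
Qed.

Lemma lifted_quadratic_min i j : i \in Emin ->
  lifted (xdiff (U_(i) + U_(j))%MM j).
Proof.
move=> i_min; apply: (lifted_root Llie (a := ebase i)).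
- by move=> D; apply: LEmin.
- by rewrite -!deg_ofU deg_ofD.
- by apply: (preserving_inner char0 Imon); rewrite mnmDE !mnm1E eqxx addn1.
Qed.

(** Let [e_i] be a minimal root below [e_l], with [l != i]. Then
    [[x_l d_i, x_i H_i] = 2 x_l H_i]; and in general
    [[x_l d_i, x_i H_j] = (1 + (j == i)) x_l H_j - (l == j) x_l H_i], where the
    last term is now known. If [e_l] is not a root, [x_l H_j] induces zero. *)
Lemma lifted_quadratic l j : lifted (xdiff (U_(l) + U_(j))%MM j).
Proof.
have [ljI|ljNI] := boolP ('X_[U_(l) + U_(j)] \in I).
  exact: (lifted_xdiff_mem kerI Llie).
have root_l : is_root I (ebase l).
  have : is_root I (deg_of (U_(l) + U_(j))%MM - ebase j).
    apply: xdiff_root => //.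
      by apply: (preserving_inner char0 Imon); rewrite mnmDE !mnm1E eqxx addn1.
    apply/eqP => /mnmP/(_ l)/eqP; rewrite mnmDE !mnm1E eqxx.
    by rewrite -[X in _ == X]add0n eqn_add2r.
  by rewrite deg_ofD !deg_ofU addrK.
have [_ domin _] := EminP; have [i i_min [li|->]] := domin l root_l; last first.
  exact: lifted_quadratic_min.
have ne_li : l != i.
  by apply: contraTneq isT => li'; case: li; rewrite li' subrr eqxx.
have Lli : lifted (xdiff U_(l)%MM i).
  apply: lifted_shift => //; apply: root_preserving; last by rewrite deg_ofU.
  by rewrite mnm1E (negPf ne_li).
have bracket q := lifted_xdiff_bracket Llie Lli (lifted_quadratic_min q i_min).
have Ei q : (U_(l) + (U_(i) + U_(q)) - U_(i) = U_(l) + U_(q))%MM.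
  by rewrite [(U_(i) + _)%MM]addmC addmA addmK.
have Eq q : (U_(l) + (U_(i) + U_(q)) - U_(q) = U_(l) + U_(i))%MM.
  by rewrite addmA addmK.
have Lii : lifted (xdiff (U_(l) + U_(i))%MM i).
  apply: (@liftedZ_inv _ _ _ _ _ Llie 2%:R); first exact: (char0_natr_neq0 char0).
  apply: lifted_eq (bracket i) => f; rewrite Ei mnmDE !mnm1E eqxx (negPf ne_li).
  by rewrite scale0r subr0.
apply: (@liftedZ_inv _ _ _ _ _ Llie (1 + (j == i))%:R); first exact: (char0_natr_neq0 char0).
apply: lifted_eq (liftedD Llie (bracket j) (liftedZ Llie (l == j)%:R Lii)) => f.
by rewrite Ei Eq mnmDE !mnm1E eqxx subrK.
Qed.

(** With [b = m + c] for a minimal generator [x^m] of [J_i], induct on [|c|]: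
    [[x^(b - e_l) d_i, x_l H_i] = x^b d_i] for [l != i] in the support of
    [c]. *)
Lemma lifted_outer b i : b i = 0%N -> preserving I b i -> lifted (xdiff b i).
Proof.
move=> bi0 /(preserving_Jideal char0 Imon) Jb.
have [m gen_m le_mb] :=
  minimal_gen_le (Jideal_ideal I i) (Jideal_monomial_closed Imon (i := i)) Jb.
have mi0 : m i = 0%N by apply/eqP; rewrite -leqn0 -bi0; move/mnm_lepP: le_mb.
have [c -> ci0] : exists2 c, b = (m + c)%MM & c i = 0%N.
  by exists (b - m)%MM; rewrite ?mnmBE ?bi0 // addmC submK.
have [d] := ubnP (mdeg c); elim: d c ci0 => // d IHd c ci0 lt_cd.
have [->|/mnm_neq0P[l cl_gt0]] := eqVneq c 0%MM.
  by rewrite addm0; apply: lifted_minimal_gen.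
have ne_li : l != i by apply: contraTneq cl_gt0 => ->; rewrite ci0.
have Lc : lifted (xdiff (m + (c - U_(l)))%MM i).
  apply: IHd; first by rewrite mnmBE ci0.
  by move: lt_cd; rewrite -{1}(submUK cl_gt0) mdegD mdeg1 addn1.
apply: lifted_eq (lifted_xdiff_bracket Llie Lc (lifted_quadratic l i)) => f.
rewrite !mnmDE !mnm1E eqxx mi0 mnmBE ci0 (negPf ne_li) scale0r subr0 scale1r.
by rewrite addmA addmK -addmA submUK.
Qed.

Lemma lifted_degree1 c i : mdeg c = 1%N -> lifted (xdiff (c + U_(i))%MM i).
Proof. by move/eqP/mdeg1P => [l /eqP ->]; apply: lifted_quadratic. Qed.

Lemma lifted_degree2 c i : c != 0%MM -> (mdeg c <= 2)%N -> c != (U_(i) *+ 2)%MM ->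
  lifted (xdiff (c + U_(i))%MM i).
Proof.
move=> c_neq0 c_le2 c_neq; have [c_gt1|c_le1] := ltnP 1 (mdeg c).
  apply: (lifted_inner_step char0 Llie) => // b j lt_bc b_neq0.
  apply: lifted_degree1; apply/eqP; rewrite eqn_leq lt0n mdeg_eq0 b_neq0 andbT.
  by rewrite -ltnS (leq_trans lt_bc).
by apply: lifted_degree1; apply/eqP; rewrite eqn_leq c_le1 lt0n mdeg_eq0.
Qed.

(** Let [a = c] be inner. As [b] is a root, [b = e - e_l] for an exponent [e],
    so [c + e = 2 e_j + e_l]. If [e_l = 0] then [e] is nonzero, since [d_l] does
    not preserve [I]; thus [|c| <= 2], and [c = 2 e_i] is impossible by parity
    of the coordinate at [l]. If [e_l > 0] then [b] is inner too, whence
    [|c| = 1]. *)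
Lemma double_root_summand j (a b : 'rV[int]_n) D :
    is_root I a -> is_root I b -> a + b = ebase j *+ 2 ->
  root_space a D -> L D.
Proof.
move=> [a_neq0 _] root_b ab Da.
apply: (root_space_lifted char0 Imon Llie Da) => c i a_i pres_c.
have [ci0|ci_gt0] := posnP (c i); first exact: lifted_outer.
have aE := shift_inner a_i ci_gt0; rewrite -(submUK ci_gt0).
move: (c - U_(i))%MM aE => {a_i pres_c ci_gt0} {}c aE.
have c_neq0 : c != 0%MM.
  apply: contraNneq a_neq0 => c0; rewrite aE c0.
  by apply/eqP/rowP => l; rewrite !mxE mnm0E.
have [l [e b_l]] := root_degree root_b.
have ceE : (c + e = U_(j) *+ 2 + U_(l))%MM.
  apply: deg_of_inj; rewrite !deg_ofD -aE -b_l addrA ab deg_ofU.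
  by rewrite deg_ofU.
have ce_deg : (mdeg c + mdeg e = 3)%N.
  by rewrite -mdegD ceE mdegD mdegMn !mdeg1.
have [el0|el_gt0] := posnP (e l).
  have e_neq0 : e != 0%MM.
    apply/eqP => e0; apply: (@not_preserving0 _ _ I char0 Imon l) => //.
    by rewrite -e0; apply: root_preserving; rewrite // -b_l addrK.
  apply: lifted_degree2 => //.
    by rewrite -ltnS -ce_deg -addn1 leq_add2l lt0n mdeg_eq0.
  (* At [l] the left side is even and the right side is odd. *)
  apply/eqP => cE; move/mnmP/(_ l): ceE.
  rewrite !mnmDE el0 cE !mulmnE !mnm1E eqxx addn0 addn1 ?muln2 ?addnn.
  by move/(congr1 odd); rewrite /= !odd_double.
have bE := shift_inner b_l el_gt0.
have mdeg_e : (1 < mdeg e)%N.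
  rewrite -(submUK el_gt0) mdegD mdeg1 addn1 ltnS lt0n mdeg_eq0.
  apply: contraTneq isT => e0; case: root_b => /eqP[].
  by rewrite bE e0; apply/rowP => r; rewrite !mxE mnm0E.
have c1 : mdeg c = 1%N.
  apply/eqP; rewrite eqn_leq lt0n mdeg_eq0 c_neq0 andbT.
  by rewrite -(leq_add2r 2) -[(1 + 2)%N]ce_deg leq_add2l.
exact: lifted_degree1.
Qed.

(** For a reducible [2 e_j], this puts its root space in [L]. *)
Lemma bracket_double_root j D :
  bracket_space (I := I) (ebase j *+ 2) D -> L D.
Proof.
apply: (lie_span Llie).
intros D' (a & b & D1 & D2 & [[root_a root_b] ab Da Db DE]).
apply: (lie_eq Llie (fun x => esym (DE x))).
apply: (lie_mem_bracket Llie); first exact: (double_root_summand root_a root_b ab).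
by apply: (double_root_summand (j := j) root_b root_a _ Db); rewrite addrC.
Qed.

Lemma lifted_double j i : lifted (xdiff (U_(j) *+ 2 + U_(i))%MM i).
Proof.
set b := (_ + _)%MM; have [bI|bNI] := boolP ('X_[b] \in I).
  exact: (lifted_xdiff_mem kerI Llie).
have pres_b : preserving I b i.
  apply: (preserving_inner char0 Imon).
  by rewrite mnmDE [U_(i)%MM i]mnm1E eqxx addn1.
have degE : ebase j *+ 2 + ebase i = deg_of b.
  by rewrite !deg_ofD !deg_ofU.
have root_j : is_root I (ebase j *+ 2).
  rewrite -[_ *+ 2](addrK (ebase i)) degE; apply: xdiff_root => //.
  rewrite /b; apply/eqP => /(congr1 (@mdeg n)).
  by rewrite mdegD mdegMn !mdeg1.
have [irr_j|red_j] := classic (irreducible_root I (ebase j *+ 2)).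
  by apply: (lifted_root Llie _ degE pres_b) => D; apply: Lirr.
have [_ redE] : reducible_root I (ebase j *+ 2).
  by apply: NNPP => nred; apply: red_j.
apply: (lifted_root Llie _ degE pres_b) => D /redE.
exact: bracket_double_root.
Qed.

Lemma lifted_inner c i : c != 0%MM -> lifted (xdiff (c + U_(i))%MM i).
Proof.
have [d] := ubnP (mdeg c); elim: d c i => // d IHd c i lt_cd c_neq0.
have [->|c_neq] := eqVneq c (U_(i) *+ 2)%MM; first exact: lifted_double.
have [c_gt1|c_le1] := ltnP 1 (mdeg c); last first.
  by apply: lifted_degree2 => //; apply: leqW.
apply: (lifted_inner_step char0 Llie) => // b j lt_bc; apply: IHd.
exact: leq_trans lt_bc lt_cd.
Qed.

Lemma lifted_torus i : lifted (xdiff U_(i)%MM i).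
Proof.
have pres_i : preserving I U_(i)%MM i.
  by apply: (preserving_inner char0 Imon); rewrite mnm1E eqxx.
apply: (lifted_root Llie (a := 0)) => //; last by rewrite add0r deg_ofU.
by move=> D [p _ pD]; apply: Ltorus; exists p.
Qed.

Lemma lifted_preserving b i : preserving I b i -> lifted (xdiff b i).
Proof.
have [bi0 pres_b|bi_gt0 _] := posnP (b i); first exact: lifted_outer.
rewrite -(submUK bi_gt0).
have [->|] := eqVneq (b - U_(i))%MM 0%MM; last exact: lifted_inner.
by rewrite add0m; apply: lifted_torus.
Qed.

Lemma derivation_generated D : derivation D -> L D.
Proof.
apply: (derivation_lifted (@quot_repK k n I) kerI char0 Imon Llie).
exact: lifted_preserving.
Qed.

End Generation.

Theorem proposition4p17 (k : closedFieldType) (hchar : [pchar k]%R =i pred0)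
    (n : nat) (hn : (0 < n)%N) (I : idealr {mpoly k[n]})
    (hmon : is_monomial_ideal (fun f => f \in I))
    (hcof : cofinite_support I)
    (hx : forall i : 'I_n, ('X_i : {mpoly k[n]})%R \notin I)
    (Emin : {set 'I_n}) (hEmin : is_minimal_roots I Emin)
    (D : {ideal_quot I} -> {ideal_quot I}) :
  derivation D <->
  lie_generated
    (fun D' : {ideal_quot I} -> {ideal_quot I} =>
       torus D' \/
       exists a : 'rV[int]_n,
         [\/ Gtilde I a,
             exists2 i : 'I_n, i \in Emin & a = ebase i |
             exists2 i : 'I_n, irreducible_root I a & a = (ebase i *+ 2)%R] /\
         root_space a D')
    D.
Proof.
split=> [derD L Llie SL|genD].
  apply: (derivation_generated hchar hmon hcof hEmin Llie) => //.
  - by move=> D' tD'; apply: SL; left.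
  - by move=> a D' Ga aD'; apply: SL; right; exists a; split=> //; constructor 1.
  - move=> i D' i_min iD'; apply: SL; right; exists (ebase i); split=> //.
    by constructor 2; exists i.
  move=> i D' irr_i iD'; apply: SL; right; exists (ebase i *+ 2)%R; split=> //.
  by constructor 3; exists i.
apply: genD; first exact: derivation_lie_subalgebra.
by move=> D' [[p /induced_hder_derivation]|[a [_ [p _ /induced_hder_derivation]]]].
Qed.
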